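(* Let $\star_1\le\star_2$ be finite-type star operations on a domain $R$. If $M$ is a $\star_1$-super potent maximal $\star_1$-ideal of $R$, then $M$ is also a $\star_2$-super potent maximal $\star_2$-ideal of $R$.
   Context: For a domain $R$ with quotient field $K$, let $\mathcal F(R)$ be the set of nonzero fractional ideals of $R$. A star operation on $R$ is a map $\star:\mathcal F(R)\to\mathcal F(R)$, $A\mapsto A^\star$, such that for all $A,B\in\mathcal F(R)$ and $c\in K\setminus(0)$: $(cA)^\star=cA^\star$ and $R^\star=R$; $A\subseteq A^\star$, and $A\subseteq B$ implies $A^\star\subseteq B^\star$; $(A^\star)^\star=A^\star$. It has finite type if, for every $A\in\mathcal F(R)$, $A^\star=\bigcup J^\star$, the union over all nonzero finitely generated subideals $J$ of $A$. One writes $\star_1\le\star_2$ if $I^{\star_1}\subseteq I^{\star_2}$ for every $I\in\mathcal F(R)$. For $I\in\mathcal F(R)$ put $I^{-1}=\{x\in K: xI\subseteq R\}$. Let $\star$ be a finite-type star operation on $R$. A $\star$-ideal is a nonzero ideal $I$ with $I^\star=I$. A maximal $\star$-ideal is an ideal of $R$ maximal among the proper $\star$-ideals. A nonzero ideal $I$ is $\star$-invertible if $(II^{-1})^\star=R$. A nonzero finitely generated ideal $I$ of $R$ is $\star$-rigid if it is contained in exactly one maximal $\star$-ideal, and $\star$-super rigid if, in addition, every finitely generated ideal $J\supseteq I$ of $R$ is $\star$-invertible. A maximal $\star$-ideal is $\star$-super potent if it contains a $\star$-super rigid ideal. *)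

(* Defs.v *)
From mathcomp Require Import all_boot all_algebra.
From mathcomp Require Import boolp classical_sets.

Set Implicit Arguments.
Unset Strict Implicit.
Unset Printing Implicit Defensive.

Import GRing.Theory.
Local Open Scope classical_set_scope.
Local Open Scope ring_scope.

(* The quotient field of R is {fraction R}. R is identified with its image    *)
(* in it, so that ideals of R and fractional ideals are both subsets of       *)
(* {fraction R}.                                                              *)

Section FractionalIdeals.
Variable R : idomainType.
Implicit Types A B I J : set {fraction R}.

Definition dom : set {fraction R} := range (@tofrac R).

Definition submodule A : Prop :=
  [/\ A 0,
      forall x y, A x -> A y -> A (x + y) &
      forall (r : R) x, A x -> A (tofrac r * x)].

Definition nonzero A : Prop := exists2 x, A x & x != 0.

(* Membership in F(R). *)
Definition fractional_ideal A : Prop :=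
  [/\ submodule A,
      nonzero A &
      exists2 d : R, d != 0 & forall x, A x -> dom (tofrac d * x)].

Definition ideal I : Prop := submodule I /\ I `<=` dom.

Definition finitely_generated A : Prop :=
  exists (n : nat) (g : 'I_n -> {fraction R}),
    A = [set x | exists c : 'I_n -> R, x = \sum_(i < n) tofrac (c i) * g i].

Definition scale (c : {fraction R}) A : set {fraction R} :=
  [set c * x | x in A].

Definition ideal_mul A B : set {fraction R} :=
  [set x | exists (n : nat) (a b : 'I_n -> {fraction R}),
    [/\ forall i, A (a i), forall i, B (b i) & x = \sum_(i < n) a i * b i]].

Definition ideal_inv I : set {fraction R} :=
  [set x | forall y, I y -> dom (x * y)].

End FractionalIdeals.

Arguments dom : clear implicits.

(* A map F(R) -> F(R) is a function on all subsets of the quotient field that *)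
(* preserves F(R); its values outside F(R) are unconstrained and never used.  *)
Record star_operation (R : idomainType) := StarOperation {
  star :> set {fraction R} -> set {fraction R};
  star_fractional : forall A, fractional_ideal A -> fractional_ideal (star A);
  star_scale : forall (c : {fraction R}) A, c != 0 -> fractional_ideal A ->
    star (scale c A) = scale c (star A);
  star_dom : star (dom R) = dom R;
  star_ext : forall A, fractional_ideal A -> A `<=` star A;
  star_mono : forall A B, fractional_ideal A -> fractional_ideal B ->
    A `<=` B -> star A `<=` star B;
  star_idem : forall A, fractional_ideal A -> star (star A) = star A
}.

Section StarOperations.
Variable R : idomainType.
Implicit Types (s : star_operation R) (A I J M : set {fraction R}).

Definition finite_type s : Prop :=
  forall A, fractional_ideal A ->
    s A = \bigcup_(J in [set J | [/\ fractional_ideal J,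
                                     finitely_generated J & J `<=` A]]) s J.

Definition star_le s1 s2 : Prop :=
  forall I, fractional_ideal I -> s1 I `<=` s2 I.

Definition star_ideal s I : Prop :=
  [/\ ideal I, nonzero I & s I = I].

Definition maximal_star_ideal s M : Prop :=
  [/\ star_ideal s M,
      M <> dom R &
      forall I, star_ideal s I -> I <> dom R -> M `<=` I -> I = M].

Definition star_invertible s I : Prop :=
  [/\ ideal I, nonzero I & s (ideal_mul I (ideal_inv I)) = dom R].

Definition star_rigid s I : Prop :=
  [/\ ideal I, nonzero I, finitely_generated I &
      exists! M, maximal_star_ideal s M /\ I `<=` M].

Definition star_super_rigid s I : Prop :=
  star_rigid s I /\
  forall J, ideal J -> finitely_generated J -> I `<=` J -> star_invertible s J.

Definition star_super_potent s M : Prop :=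
  maximal_star_ideal s M /\ exists2 I, star_super_rigid s I & I `<=` M.

End StarOperations.

(* Main.v *)
Require Import Defs.
From mathcomp Require Import all_boot all_algebra.
From mathcomp Require Import boolp classical_sets.

(** The key point is that an ideal [J] which is invertible for the smaller
    operation [s1] cannot become trivial under the larger one without being
    trivial already: if [J^s2 = R], then [x J <= R] forces [x R = x J^s2 <= R],
    so [J^-1 = R], hence [J J^-1 = J] and [s1]-invertibility reads [J^s1 = R].
    Let [I] be an [s1]-super rigid ideal in [M], and let [A] be any proper
    [s1]-ideal containing [I].  If [A^s2] were [R], finite type would put [1] in
    the [s2]-closure of a finitely generated part of [A]; adding [I] to it gives
    an [s1]-invertible [J] with [I <= J <= A] and [J^s2 = R], whence
    [R = J^s1 <= A].  So [A^s2] is a proper [s2]-ideal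
    ([star_ideal_closure_proper]).

    Since [s2]-ideals are [s1]-ideals ([star_ideal_le]), it follows that above
    [I] the maximal [s1]-ideals and the maximal [s2]-ideals are the same
    ([maximal_star_ideal_le] and [maximal_star_ideal_ge]).  Hence [M] is a
    maximal [s2]-ideal, and it is the only one containing [I].  Finally
    [s1]-invertible ideals are [s2]-invertible ([star_invertible_le]), so [I] is
    [s2]-super rigid. *)

Set Implicit Arguments.
Unset Strict Implicit.
Unset Printing Implicit Defensive.

Import GRing.Theory.
Local Open Scope classical_set_scope.
Local Open Scope ring_scope.

(** * Arithmetic of ideals and their closures *)

Section Ideals.
Variable R : idomainType.
Implicit Types (A B I J : set {fraction R}) (s : star_operation R).

Lemma dom1 : dom R 1.
Proof. by exists 1; rewrite ?rmorph1. Qed.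

Lemma dom_submodule : submodule (dom R).
Proof.
split=> [|_ _ [a _ <-] [b _ <-]|r _ [a _ <-]].
- by exists 0; rewrite ?rmorph0.
- by exists (a + b); rewrite ?rmorphD.
- by exists (r * a); rewrite ?rmorphM.
Qed.

Lemma submodule_sum A n (f : 'I_n -> {fraction R}) :
  submodule A -> (forall i, A (f i)) -> A (\sum_(i < n) f i).
Proof. by case=> A0 AD _ Af; elim/big_ind: _ => // i _; exact: Af. Qed.

Lemma submodule_ideal_mul A B : submodule A -> submodule (ideal_mul A B).
Proof.
move=> [_ _ AZ]; split.
- exists 0, (fun=> 0), (fun=> 0); split; [by case|by case|].
  by rewrite big_ord0.
- move=> _ _ [m [a [b [Aa Bb ->]]]] [n [a' [b' [Aa' Bb' ->]]]].
  pose cat (u : 'I_m -> {fraction R}) (v : 'I_n -> {fraction R}) i :=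
    match split i with inl j => u j | inr k => v k end.
  exists (m + n)%N, (cat a a'), (cat b b'); split.
  + by move=> i; rewrite /cat; case: (split i).
  + by move=> i; rewrite /cat; case: (split i).
  + rewrite big_split_ord /cat; congr (_ + _); apply: eq_bigr => i _.
      by rewrite -[lshift n i]/(unsplit (inl i)) unsplitK.
    by rewrite -[rshift m i]/(unsplit (inr i)) unsplitK.
- move=> r _ [n [a [b [Aa Bb ->]]]].
  exists n, (fun i => tofrac r * a i), b; split=> // [i|]; first exact: AZ.
  by rewrite mulr_sumr; apply: eq_bigr => i _; rewrite mulrA.
Qed.

Lemma ideal_fractional I : ideal I -> nonzero I -> fractional_ideal I.
Proof.
move=> [smI Idom] nzI; split=> //; exists 1; first exact: oner_neq0.
by move=> x Ix; rewrite rmorph1 mul1r; apply: Idom.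
Qed.

Lemma dom_fractional : fractional_ideal (dom R).
Proof.
apply: ideal_fractional; first by split; [exact: dom_submodule|].
by exists 1; [exact: dom1|exact: oner_neq0].
Qed.

Lemma nonzero_subset A B : A `<=` B -> nonzero A -> nonzero B.
Proof. by move=> AB [x Ax x0]; exists x; first exact: AB. Qed.

Lemma ideal_eq_dom I : ideal I -> I 1 -> I = dom R.
Proof.
move=> [[_ _ IZ] Idom] I1; rewrite eqEsubset; split=> // _ [a _ <-].
by rewrite -[tofrac a]mulr1; apply: IZ.
Qed.

Lemma ideal_inv1 I : I `<=` dom R -> ideal_inv I 1.
Proof. by move=> Idom y Iy; rewrite mul1r; apply: Idom. Qed.

Lemma ideal_mul_inv I : ideal I -> ideal (ideal_mul I (ideal_inv I)).
Proof.
move=> [smI Idom]; split; first exact: submodule_ideal_mul.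
move=> _ [n [a [b [Ia Ib ->]]]]; apply: submodule_sum; first exact: dom_submodule.
by move=> i; rewrite mulrC; apply: Ib.
Qed.

Lemma sub_ideal_mul_inv I : I `<=` dom R -> I `<=` ideal_mul I (ideal_inv I).
Proof.
move=> Idom x Ix; exists 1%N, (fun=> x), (fun=> 1); split=> // [_|].
  exact: ideal_inv1.
by rewrite big_ord1 mulr1.
Qed.

Lemma ideal_mul_inv_fractional I : ideal I -> nonzero I ->
  fractional_ideal (ideal_mul I (ideal_inv I)).
Proof.
move=> idI nzI; apply: ideal_fractional; first exact: ideal_mul_inv.
by apply: nonzero_subset nzI; apply: sub_ideal_mul_inv; case: idI.
Qed.

Definition ideal_add A B : set {fraction R} := [set a + b | a in A & b in B].

Lemma submodule_add A B : submodule A -> submodule B ->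
  submodule (ideal_add A B).
Proof.
move=> [A0 AD AZ] [B0 BD BZ]; split.
- by exists 0 => //; exists 0; rewrite ?addr0.
- move=> _ _ [a Aa [b Bb <-]] [a' Aa' [b' Bb' <-]].
  by exists (a + a'); [exact: AD|exists (b + b'); [exact: BD|rewrite addrACA]].
- move=> r _ [a Aa [b Bb <-]]; exists (tofrac r * a); first exact: AZ.
  by exists (tofrac r * b); [exact: BZ|rewrite mulrDr].
Qed.

Lemma ideal_add_subl A B : submodule B -> A `<=` ideal_add A B.
Proof. by move=> [B0 _ _] a Aa; exists a => //; exists 0; rewrite ?addr0. Qed.

Lemma ideal_add_subr A B : submodule A -> B `<=` ideal_add A B.
Proof. by move=> [A0 _ _] b Bb; exists 0 => //; exists b; rewrite ?add0r. Qed.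

Lemma ideal_add_sub A B I : submodule I -> A `<=` I -> B `<=` I ->
  ideal_add A B `<=` I.
Proof.
by move=> [_ ID _] AI BI _ [a Aa [b Bb <-]]; apply: ID; [exact: AI|exact: BI].
Qed.

Lemma finitely_generated_add A B : finitely_generated A ->
  finitely_generated B -> finitely_generated (ideal_add A B).
Proof.
move=> [m [g ->]] [n [h ->]].
pose gh i := match split i with inl j => g j | inr k => h k end.
have ghl (i : 'I_m) : gh (lshift n i) = g i.
  by rewrite /gh -[lshift n i]/(unsplit (inl i)) unsplitK.
have ghr (i : 'I_n) : gh (rshift m i) = h i.
  by rewrite /gh -[rshift m i]/(unsplit (inr i)) unsplitK.
exists (m + n)%N, gh; rewrite eqEsubset; split.
- move=> _ [_ [c ->] [_ [d ->] <-]].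
  exists (fun i => match split i with inl j => c j | inr k => d k end).
  rewrite big_split_ord; congr (_ + _); apply: eq_bigr => i _.
    by rewrite ghl -[lshift n i]/(unsplit (inl i)) unsplitK.
  by rewrite ghr -[rshift m i]/(unsplit (inr i)) unsplitK.
- move=> _ [c ->]; rewrite big_split_ord.
  exists (\sum_(i < m) tofrac (c (lshift n i)) * g i); first by eexists.
  exists (\sum_(i < n) tofrac (c (rshift m i)) * h i); first by eexists.
  by congr (_ + _); apply: eq_bigr => i _; rewrite ?ghl ?ghr.
Qed.

Lemma scale_fractional c A : c != 0 -> scale c A `<=` dom R ->
  fractional_ideal A -> fractional_ideal (scale c A).
Proof.
move=> c0 cAdom [[A0 AD AZ] [x Ax x0] _]; apply: ideal_fractional; last first.
  by exists (c * x); [exists x|rewrite mulf_neq0].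
split=> //; split=> [|_ _ [a Aa <-] [b Ab <-]|r _ [a Aa <-]].
- by exists 0; rewrite ?mulr0.
- by exists (a + b); [exact: AD|rewrite mulrDr].
- by exists (tofrac r * a); [exact: AZ|rewrite mulrCA].
Qed.

Lemma star_sub_dom s I : ideal I -> nonzero I -> s I `<=` dom R.
Proof.
move=> idI nzI; rewrite -(star_dom s); apply: star_mono.
- exact: ideal_fractional.
- exact: dom_fractional.
- by case: idI.
Qed.

Lemma star_idealP s I : ideal I -> nonzero I -> star_ideal s (s I).
Proof.
move=> idI nzI; have frI := ideal_fractional idI nzI.
have [smsI nzsI _] := star_fractional s frI.
by split; [split=> //; exact: star_sub_dom|by []|exact: star_idem].
Qed.

(** Multiplication by [x] commutes with [s], so the bound [x I <= R] passes to
    [I^s], which contains [1]. *)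
Lemma ideal_inv_sub_dom s I : fractional_ideal I -> s I 1 ->
  ideal_inv I `<=` dom R.
Proof.
move=> frI sI1 x xI; have [->|x0] := eqVneq x 0.
  by exists 0; rewrite ?rmorph0.
have xIdom : scale x I `<=` dom R by move=> _ [y Iy <-]; apply: xI.
have frxI := scale_fractional x0 xIdom frI.
rewrite -(star_dom s); apply: (star_mono (s := s) frxI dom_fractional xIdom).
by rewrite star_scale //; exists 1; rewrite ?mulr1.
Qed.

End Ideals.

(** * Passing to a larger star operation *)

Section ComparableStarOperations.
Variables (R : idomainType) (s1 s2 : star_operation R).
Hypothesis le12 : star_le s1 s2.
Implicit Types (A I J M : set {fraction R}).

Lemma star_ideal_le A : star_ideal s2 A -> star_ideal s1 A.
Proof.
move=> [idA nzA s2A]; split=> //; have frA := ideal_fractional idA nzA.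
rewrite eqEsubset; split; last exact: star_ext.
by rewrite -[X in _ `<=` X]s2A; apply: le12.
Qed.

Lemma star_invertible_le J : star_invertible s1 J -> star_invertible s2 J.
Proof.
move=> [idJ nzJ JJ1]; split=> //.
have frJ := ideal_mul_inv_fractional idJ nzJ; have [_ nzJJ _] := frJ.
rewrite eqEsubset; split; first by apply: star_sub_dom => //; exact: ideal_mul_inv.
by rewrite -[X in X `<=` _]JJ1; apply: le12.
Qed.

(** When [J^s2 = R], the inverse of [J] is [R], and [s1]-invertibility collapses
    to [J^s1 = R]. *)
Lemma star_invertible_dom J A : star_invertible s1 J -> s2 J 1 ->
  star_ideal s1 A -> J `<=` A -> A = dom R.
Proof.
move=> [idJ nzJ JJ1] s2J1 [idA nzA s1A] JA.
have invJ := ideal_inv_sub_dom (ideal_fractional idJ nzJ) s2J1.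
apply: ideal_eq_dom => //; rewrite -s1A.
have JJA : ideal_mul J (ideal_inv J) `<=` A.
  have [smA _] := idA; have [_ _ AZ] := smA.
  move=> _ [n [a [b [Ja Jb ->]]]]; apply: submodule_sum => // i.
  by have [r _ <-] := invJ _ (Jb i); rewrite mulrC; apply: AZ; apply: JA.
apply: (star_mono (s := s1) _ _ JJA).
- exact: ideal_mul_inv_fractional.
- exact: ideal_fractional.
- by rewrite JJ1; apply: dom1.
Qed.

Hypothesis fin2 : finite_type s2.
Variable I : set {fraction R}.
Hypothesis rigidI : star_super_rigid s1 I.

(** Finite type reduces [A^s2 = R] to a finitely generated subideal of [A], which
    can be enlarged by [I] inside [A] so as to become [s1]-invertible. *)
Lemma star_ideal_closure_proper A : star_ideal s1 A -> A <> dom R ->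
  I `<=` A -> s2 A <> dom R.
Proof.
move=> siA Aproper IA s2A; apply: Aproper.
have [[idI nzI fgI _] invI] := rigidI; have [idA nzA _] := siA.
have [[smA Adom] [smI _]] := (idA, idI).
have : s2 A 1 by rewrite s2A; apply: dom1.
rewrite (fin2 (ideal_fractional idA nzA)) => -[J [frJ fgJ JA] s2J1].
have [smJ nzJ _] := frJ.
have JIA : ideal_add J I `<=` A by apply: ideal_add_sub.
have idJI : ideal (ideal_add J I).
  by split; [exact: submodule_add|exact: subset_trans Adom].
have JJI : J `<=` ideal_add J I by apply: ideal_add_subl.
have frJI : fractional_ideal (ideal_add J I).
  by apply: ideal_fractional => //; apply: nonzero_subset nzJ.
apply: (star_invertible_dom (J := ideal_add J I)) => //.
- by apply: invI => //; [exact: finitely_generated_add|exact: ideal_add_subr].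
- exact: (star_mono (s := s2) frJ frJI JJI).
Qed.

Lemma maximal_star_ideal_le M : maximal_star_ideal s1 M -> I `<=` M ->
  maximal_star_ideal s2 M.
Proof.
move=> [siM Mproper maxM] IM; have [idM nzM _] := siM.
have si2M := star_idealP s2 idM nzM.
(* The s2-closure of M is a proper s1-ideal above M, hence M itself. *)
have s2M : s2 M = M.
  apply: maxM; first exact: star_ideal_le.
  - exact: star_ideal_closure_proper.
  - by apply: star_ext; exact: ideal_fractional.
split=> // A siA Aproper MA; apply: maxM => //.
exact: star_ideal_le.
Qed.

(** A proper [s1]-ideal [A] above [M] has a proper [s2]-closure, which
    [s2]-maximality squeezes down to [M]. *)
Lemma maximal_star_ideal_ge M : maximal_star_ideal s2 M -> I `<=` M ->
  maximal_star_ideal s1 M.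
Proof.
move=> [siM Mproper maxM] IM; split=> //; first exact: star_ideal_le.
move=> A siA Aproper MA; have [idA nzA _] := siA.
have As2A : A `<=` s2 A by apply: star_ext; exact: ideal_fractional.
have s2A : s2 A = M.
  apply: maxM; first exact: star_idealP.
  - by apply: star_ideal_closure_proper => //; exact: subset_trans MA.
  - exact: subset_trans As2A.
by rewrite eqEsubset; split=> //; rewrite -s2A.
Qed.

Lemma star_super_rigid_le : star_super_rigid s2 I.
Proof.
have [[idI nzI fgI [M [[maxM IM] uniqM]]] invI] := rigidI.
split; last by move=> J *; apply: star_invertible_le; exact: invI.
split=> //; exists M; split; first by split=> //; exact: maximal_star_ideal_le.
move=> N [maxN IN]; apply: uniqM; split=> //.
exact: maximal_star_ideal_ge.
Qed.

End ComparableStarOperations.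

Theorem theorem1p5 (R : idomainType) (s1 s2 : star_operation R)
    (fin1 : finite_type s1) (fin2 : finite_type s2) (le12 : star_le s1 s2)
    (M : set {fraction R}) :
  maximal_star_ideal s1 M -> star_super_potent s1 M ->
  maximal_star_ideal s2 M /\ star_super_potent s2 M.
Proof.
move=> maxM [_ [I rigidI IM]].
have max2M := maximal_star_ideal_le le12 fin2 rigidI maxM IM.
split=> //; split=> //; exists I => //.
exact: (star_super_rigid_le le12 fin2 rigidI).
Qed.
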